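(* Let $p>5$ be prime and let $\mathbf{x}=(x_1,x_2,x_3)\in\mathcal{X}^*(p)$. Suppose that for some $i\in\{1,2,3\}$ the coordinate $x_i$ is elliptic and the Legendre symbol satisfies \[\left(\frac{3x_i+2}{p}\right)=-1.\] Then $2^{\nu}$ divides $\mathrm{ord}_{p,i}(\mathbf{x})$, where $\nu=\nu_2(p+1)$ is the $2$-adic valuation of $p+1$.
   Context: $\mathcal{X}^*(p)$ denotes the set of nonzero solutions $(x_1,x_2,x_3)\in\mathbb{F}_p^3\setminus\{(0,0,0)\}$ of the Markoff equation $x_1^2+x_2^2+x_3^2=3x_1x_2x_3$. The rotations are the maps $\mathrm{rot}_1(x_1,x_2,x_3)=(x_1,x_3,3x_1x_3-x_2)$, $\mathrm{rot}_2(x_1,x_2,x_3)=(x_3,x_2,3x_2x_3-x_1)$, $\mathrm{rot}_3(x_1,x_2,x_3)=(x_2,3x_2x_3-x_1,x_3)$ on $\mathcal{X}^*(p)$. The $i$th rotation order is $\mathrm{ord}_{p,i}(\mathbf{x})=\min\{n\in\mathbb{Z}_{>0}: \mathrm{rot}_i^n(\mathbf{x})\equiv\mathbf{x}\pmod p\}$ (equivalently, the order of $\begin{pmatrix}0&1\\-1&3x_i\end{pmatrix}$ in $\mathrm{GL}_2(\mathbb{F}_p)$). For $x\in\mathbb{F}_p$, let $\Delta_x=9x^2-4$ be the discriminant of $T^2-3xT+1$; $x$ is called elliptic if $\Delta_x$ is not a square modulo $p$. *)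

(* Defs.v *)
From HB Require Import structures.
From mathcomp Require Import all_boot all_order all_algebra.
From mathcomp Require Import ring.
Set Implicit Arguments.
Unset Strict Implicit.
Unset Printing Implicit Defensive.
Import GRing.Theory.
Local Open Scope ring_scope.

(* Throughout, p is meant to be prime: 'F_p is the field with p elements
   only under that hypothesis. *)

Definition point (p : nat) : finType := ('F_p * 'F_p * 'F_p)%type.

(* Coordinates and rotations are indexed from 0: the index i : 'I_3 stands for
   the (i + 1)-st coordinate. *)
Definition pcoord (p : nat) (i : 'I_3) (x : point p) : 'F_p :=
  let: (x1, x2, x3) := x in tnth [tuple x1; x2; x3] i.

Definition markoff_star (p : nat) : {set point p} :=
  [set x : point p | let: (x1, x2, x3) := x in
     (x != (0, 0, 0)) && (x1 ^+ 2 + x2 ^+ 2 + x3 ^+ 2 == 3 * x1 * x2 * x3)].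

(* The rotations are defined on all of F_p^3; rotation_markoff shows that they
   restrict to maps of markoff_star p into itself. *)
Definition rot1 (p : nat) (x : point p) : point p :=
  let: (x1, x2, x3) := x in (x1, x3, 3 * x1 * x3 - x2).

Definition rot2 (p : nat) (x : point p) : point p :=
  let: (x1, x2, x3) := x in (x3, x2, 3 * x2 * x3 - x1).

Definition rot3 (p : nat) (x : point p) : point p :=
  let: (x1, x2, x3) := x in (x2, 3 * x2 * x3 - x1, x3).

Definition rotation (p : nat) (i : 'I_3) : point p -> point p :=
  tnth [tuple @rot1 p; @rot2 p; @rot3 p] i.

Lemma rotation_inj (p : nat) (i : 'I_3) : injective (@rotation p i).
Proof.
case: i => [[|[|[|//]]] i_lt3]; rewrite /rotation (tnth_nth id) /=;
  move=> [[x1 x2] x3] [[y1 y2] y3] /eqP;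
  rewrite !xpair_eqE => /andP[/andP[/eqP h1 /eqP h2] /eqP h3].
- by move: h3; rewrite h1 h2 => /addrI /oppr_inj ->.
- by move: h3; rewrite h1 h2 => /addrI /oppr_inj ->.
- by move: h2; rewrite h1 h3 => /addrI /oppr_inj ->.
Qed.

Lemma rotation_markoff (p : nat) (i : 'I_3) (x : point p) :
  x \in markoff_star p -> rotation i x \in markoff_star p.
Proof.
rewrite !inE; case: x => [[x1 x2] x3] /andP[x_neq0 /eqP mx].
have mx0 : x1 ^+ 2 + x2 ^+ 2 + x3 ^+ 2 - 3 * x1 * x2 * x3 = 0.
  by rewrite mx subrr.
case: i => [[|[|[|//]]] i_lt3]; rewrite /rotation (tnth_nth id) /=;
  (apply/andP; split;
    [ apply: contra x_neq0; rewrite !xpair_eqE =>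
        /andP[/andP[/eqP h1 /eqP h2] /eqP h3]
    | by rewrite -subr_eq0 -mx0; apply/eqP; ring ]).
- by move: h3; rewrite h1 h2 mulr0 sub0r => /eqP; rewrite oppr_eq0 => ->; rewrite eqxx.
- by move: h3; rewrite h1 h2 mulr0 sub0r => /eqP; rewrite oppr_eq0 => ->; rewrite eqxx.
- by move: h2; rewrite h1 h3 mulr0 sub0r => /eqP; rewrite oppr_eq0 => ->; rewrite eqxx.
Qed.

Lemma rotation_periodic (p : nat) (i : 'I_3) (x : point p) :
  exists n, (0 < n)%N && (iter n (rotation i) x == x).
Proof.
exists (order (rotation i) x).
by rewrite order_gt0 (iter_order (@rotation_inj p i)) eqxx.
Qed.

Definition rotation_order (p : nat) (i : 'I_3) (x : point p) : nat :=
  ex_minn (rotation_periodic i x).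

Definition is_square (p : nat) (a : 'F_p) : bool :=
  [exists y : 'F_p, y ^+ 2 == a].

Definition legendre (p : nat) (a : 'F_p) : int :=
  if a == 0 then 0 else if is_square a then 1 else -1.

Definition discr (p : nat) (x : 'F_p) : 'F_p := 9 * x ^+ 2 - 4.

Definition elliptic (p : nat) (x : 'F_p) : bool := ~~ is_square (discr x).

(* Main.v *)
(* Put t = 3 x_i. Rotation i acts on the two moving coordinates through a matrix
   M with M^2 = t M - 1, and these coordinates are not both 0. As t^2 - 4 is
   not a square, Frobenius conjugates M, i.e. M^p = t - M = M^-1, so that
   M (M + 1)^p = M + 1. On the other hand (M + 1)^2 = (t + 2) M with t + 2 a
   nonsquare, so (M + 1)^(p - 1) = - M^((p - 1) / 2). Comparing the two,
   M^((p + 1) / 2) = -1, which fixes no nonzero vector: the order of the rotation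
   at x divides p + 1 but not (p + 1) / 2. *)

Require Import Defs.
From HB Require Import structures.
From mathcomp Require Import all_boot all_order all_algebra.
From mathcomp Require Import fingroup cyclic finfield ring.
Set Implicit Arguments.
Unset Strict Implicit.
Unset Printing Implicit Defensive.
Import GRing.Theory.
Local Open Scope ring_scope.

Lemma two_Fp_neq0 (p : nat) : prime p -> odd p -> 2 != 0 :> 'F_p.
Proof.
move=> p_prime p_odd; rewrite -(dvdn_pcharf (pchar_Fp p_prime)) dvdn_prime2 //.
by apply: contraTneq p_odd => ->.
Qed.

(** One half of Euler's criterion: $a^{p-1} = 1$ leaves only $\pm 1$ for the power, and the value
    $1$ would yield a square root of [a]. *)
Lemma nonsquare_expf_half (p : nat) (a : 'F_p) :
  prime p -> odd p -> ~~ is_square a -> a ^+ p./2 = -1.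
Proof.
move=> p_prime p_odd a_nsq.
have p_gt1 := prime_gt1 p_prime.
have pE : p = p./2.*2.+1 by rewrite -[LHS]odd_double_half p_odd.
have a_neq0 : a != 0.
  by apply: contraNneq a_nsq => ->; apply/existsP; exists 0; rewrite expr0n.
have ap : a ^+ p.-1 = 1.
  apply: (mulfI a_neq0); rewrite -exprS prednK ?prime_gt0 // mulr1.
  by have := expf_card a; rewrite card_Fp.
have : (a ^+ p./2) ^+ 2 == 1.
  by rewrite -exprM muln2 -[p./2.*2]/(p./2.*2.+1.-1) -pE ap.
rewrite sqrf_eq1 => /orP[/eqP a_half|/eqP //].
case/negP: a_nsq; have ua : a \is a GRing.unit by rewrite unitfE.
have /cyclicP[g gE] := field_unit_group_cyclic [set: {unit 'F_p}]%G.
have : FinRing.unit 'F_p ua \in <[g]>%g by rewrite -gE inE.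
case/cycleP=> k /(congr1 val) /=; rewrite FinRing.val_unitX => akE.
have og : #[g]%g = p./2.*2.
  by rewrite orderE -gE card_finField_unit card_Fp // [X in X.-1]pE.
(* With $a = g^k$ and [g] of order $p - 1$, $a^{(p-1)/2} = 1$ forces [k] to be even. *)
have : (#[g]%g %| k * p./2)%N.
  by rewrite order_dvdn; apply/eqP/val_inj; rewrite FinRing.val_unitX exprM -akE.
rewrite og -muln2 mulnC dvdn_pmul2r ?half_gt0 // => /dvdnP[m kE].
by apply/existsP; exists (val g ^+ m); rewrite -exprM -kE -akE.
Qed.

Lemma root_expr_half (p : nat) (A : algType 'F_p) (t : 'F_p) (M : A) :
  prime p -> odd p -> M ^+ 2 = t *: M - 1 ->
  ~~ is_square (t ^+ 2 - 4) -> ~~ is_square (t + 2) -> M ^+ p.+1./2 = -1.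
Proof.
move=> p_prime p_odd M2 D_nsq t2_nsq.
have pE : p = p./2.*2.+1 by rewrite -[LHS]odd_double_half p_odd.
have exp_p (R : nzRingType) (y : R) : y ^+ p = y * (y ^+ 2) ^+ p./2.
  by rewrite [in LHS]pE exprS -muln2 mulnC exprM.
have pP : p \in [pchar {poly 'F_p}] by rewrite pchar_lalg pchar_Fp.
have two_neq0 := two_Fp_neq0 p_prime p_odd.
have t2_neq0 : t + 2 != 0.
  by apply: contraNneq t2_nsq => ->; apply/existsP; exists 0; rewrite expr0n.
have fermat (c : 'F_p) : c ^+ p = c.
  by have := expf_card c; rewrite card_Fp.
(* [A] need not be commutative, so Frobenius is applied in [{poly 'F_p}] and its identities are
   transported by evaluation at [M], which kills [q]. *)
have [phi [phiX phiC]] : exists phi : {rmorphism {poly 'F_p} -> A},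
    phi 'X = M /\ forall c, phi c%:P = c%:A.
  by exists (horner_alg M); split; [exact: horner_algX | exact: horner_algC].
pose q : {poly 'F_p} := 'X^2 - t%:P * 'X + 1.
have phi_q : phi q = 0.
  rewrite rmorphD rmorphB rmorphXn rmorphM rmorph1 phiX phiC M2 mulr_algl.
  by rewrite [t *: M - 1 - _]addrAC subrr sub0r addNr.
have frobX : M ^+ p = t%:A - M.
  (* Completing the square: $(2M - t)^2$ is the nonsquare $t^2 - 4$, so $(2M - t)^p = -(2M - t)$,
     while Frobenius gives $2M^p - t$. *)
  have sqE : phi ((2%:P * 'X - t%:P) ^+ 2) = (t ^+ 2 - 4)%:A.
    have -> : (2%:P * 'X - t%:P) ^+ 2 = (t ^+ 2 - 4)%:P + 4 * q.
      by rewrite /q rmorphB rmorphXn /=; ring.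
    by rewrite rmorphD rmorphM phi_q mulr0 addr0 phiC.
  have : (2%:P * 'X - t%:P) ^+ p = 2%:P * 'X^p - t%:P :> {poly 'F_p}.
    rewrite -(pFrobenius_autE pP) rmorphB rmorphM /= !pFrobenius_autE.
    by rewrite -!polyC_exp !fermat.
  rewrite exp_p => /(congr1 phi); rewrite rmorphM [phi (_ ^+ p./2)]rmorphXn sqE.
  rewrite -phiC -rmorphXn -polyC_exp nonsquare_expf_half // phiC scaleN1r mulrN1.
  rewrite -rmorphN opprB => /eqP; rewrite -subr_eq0 -rmorphB /=.
  have -> : t%:P - 2%:P * 'X - (2%:P * 'X^p - t%:P)
            = 2%:P * (t%:P - 'X - 'X^p) :> {poly 'F_p} by ring.
  rewrite rmorphM phiC mulr_algl scaler_eq0 (negPf two_neq0) /=.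
  by rewrite !rmorphB rmorphXn phiX phiC subr_eq0 => /eqP.
have MT : M * (t%:A - M) = 1.
  by rewrite mulrBr -expr2 M2 mulr_algr opprB addrC subrK.
have TM : (t%:A - M) * M = 1.
  by rewrite mulrBl -expr2 M2 mulr_algl opprB addrC subrK.
have sqE : (M + 1) ^+ 2 = (t + 2) *: M.
  by rewrite sqrrD1 M2 scalerDl scaler_nat addrAC subrK.
have halfE : p.+1./2 = p./2.+1 by rewrite [in LHS]pE /= doubleK.
rewrite halfE.
have succM_mul : (M + 1) * (M ^+ p./2.+1 + 1) = 0.
  have : 'X * ('X + 1) ^+ p = 'X * ('X^p + 1) :> {poly 'F_p}.
    by rewrite -(pFrobenius_autE pP) rmorphD rmorph1 /= pFrobenius_autE.
  move=> /(congr1 phi); rewrite !(rmorphM, rmorphXn, rmorphD, rmorph1) /= phiX.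
  rewrite exp_p sqE exprZn nonsquare_expf_half // scaleN1r frobX.
  rewrite [RHS]mulrDr MT mulr1 !mulrN => /eqP.
  rewrite eq_sym -addr_eq0 => /eqP eq0; rewrite exprS mulrDr mulr1 -[RHS]eq0.
  by rewrite addrC [M + 1]addrC !mulrA mulrDl mulrDr mul1r mulr1.
(* The factor $M + 1$ cancels: one more multiplication by it gives $(t + 2) M$, where $t + 2 \neq 0$
   and [M] has inverse $t - M$. *)
have /eqP : (t + 2) *: (M * (M ^+ p./2.+1 + 1)) = 0.
  by rewrite scalerAl -sqE expr2 -mulrA succM_mul mulr0.
rewrite scaler_eq0 (negPf t2_neq0) => /eqP /(congr1 ( *%R (t%:A - M))).
by rewrite mulrA TM mul1r mulr0 => /eqP; rewrite addr_eq0 => /eqP.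
Qed.

(** The remainder of [n] modulo the order also fixes [x], so by minimality it is zero. *)
Lemma rotation_order_dvdn (p : nat) (i : 'I_3) (x : point p) n :
  (rotation_order i x %| n)%N = (iter n (rotation i) x == x).
Proof.
rewrite /rotation_order; case: ex_minnP => m /andP[m_gt0 /eqP mx] m_min.
have mul_x k : iter (k * m) (rotation i) x = x.
  by elim: k => // k IHk; rewrite mulSn iterD IHk.
rewrite {2}(divn_eq n m) addnC iterD mul_x /dvdn.
apply/eqP/eqP => [-> //| rx].
have := ltn_pmod n m_gt0; case: (posnP (n %% m)) => // r_gt0.
by rewrite ltnNge m_min // r_gt0 rx eqxx.
Qed.

Section MarkoffRotation.

Variables (p : nat) (i : 'I_3).

(** In this ordering every rotation acts as $(u, v) \mapsto (v, 3 x_i v - u)$, so one matrix serves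
    all three indices. *)
Definition moving_coords (x : point p) : 'cV['F_p]_2 :=
  let: (x1, x2, x3) := x in
  \col_j tnth (tnth [tuple [tuple x2; x3]; [tuple x1; x3]; [tuple x1; x2]] i) j.

(** A companion matrix of $T^2 - tT + 1$. *)
Definition rotation_mx (t : 'F_p) : 'M['F_p]_2 :=
  \matrix_(j, k) if j == 0 then (k == 1)%:R else if k == 0 then - 1 else t.

Lemma rotation_mx_sqr (t : 'F_p) :
  rotation_mx t ^+ 2 = t *: rotation_mx t - 1.
Proof.
apply/matrixP=> j k; rewrite expr2 !mxE !big_ord_recl big_ord0 !mxE.
by case: j k => [[|[|//]] ?] [[|[|//]] ?] /=; ring.
Qed.

Lemma pcoord_rotation (x : point p) : pcoord i (rotation i x) = pcoord i x.
Proof.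
case: x => [[x1 x2] x3]; rewrite /rotation /pcoord.
by case: i => [[|[|[|//]]] ?]; rewrite !(tnth_nth id) /= !(tnth_nth 0).
Qed.

Lemma moving_coords_rotation (x : point p) :
  moving_coords (rotation i x) = rotation_mx (3 * pcoord i x) *m moving_coords x.
Proof.
apply/colP=> j; case: x => [[x1 x2] x3].
rewrite /rotation /pcoord /moving_coords.
case: i => [[|[|[|//]]] ?].
all: rewrite !(tnth_nth id) /= !mxE !big_ord_recl big_ord0 !mxE.
all: case: j => [[|[|//]] ?]; rewrite !(tnth_nth [tuple 0; 0]) !(tnth_nth 0) /=.
all: ring.
Qed.

Lemma moving_coords_iter n (x : point p) :
  moving_coords (iter n (rotation i) x)
    = rotation_mx (3 * pcoord i x) ^+ n *m moving_coords x.
Proof.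
elim: n => [|n IHn]; first by rewrite mul1mx.
rewrite iterS moving_coords_rotation IHn exprS mulmxA.
congr (rotation_mx (3 * _) *m _ *m _).
by elim: n {IHn} => // n IHn; rewrite iterS pcoord_rotation.
Qed.

Lemma moving_coords_inj (x y : point p) :
  pcoord i x = pcoord i y -> moving_coords x = moving_coords y -> x = y.
Proof.
case: x y => [[x1 x2] x3] [[y1 y2] y3] xy /colP exy.
move: xy (exy ord0) (exy ord_max); rewrite /pcoord /moving_coords !mxE.
by case: i => [[|[|[|//]]] ?];
   rewrite !(tnth_nth [tuple 0; 0]) !(tnth_nth 0) /= => -> -> ->.
Qed.

(** If both moving coordinates vanish, the Markoff equation reduces to $x_i^2 = 0$, hence $x =
    0$. *)
Lemma moving_coords_neq0 (x : point p) :
  x \in markoff_star p -> moving_coords x != 0.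
Proof.
rewrite inE; case: x => [[x1 x2] x3] /andP[x_neq0 x_eq].
apply: contraNneq x_neq0 => /colP x0.
move: (x0 ord0) (x0 ord_max) x_eq; rewrite /moving_coords !mxE.
by case: i => [[|[|[|//]]] ?];
   rewrite !(tnth_nth [tuple 0; 0]) !(tnth_nth 0) /= => -> ->;
   rewrite !(mulr0, mul0r, expr0n, addr0, add0r) sqrf_eq0 => /eqP ->.
Qed.

End MarkoffRotation.

Theorem theorem2p10 (p : nat) (p_prime : prime p) (p_gt5 : (5 < p)%N)
    (x : point p) (x_markoff : x \in markoff_star p) (i : 'I_3)
    (xi_elliptic : elliptic (pcoord i x))
    (xi_legendre : legendre (3 * pcoord i x + 2) = -1) :
  (2 ^ logn 2 p.+1 %| rotation_order i x)%N.
Proof.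
have p_odd : odd p by case/even_prime: p_prime p_gt5 => [->|].
set t := 3 * pcoord i x.
have D_nsq : ~~ is_square (t ^+ 2 - 4).
  by move: xi_elliptic; rewrite /elliptic /discr /t; congr (~~ is_square _); ring.
have t2_nsq : ~~ is_square (t + 2).
  by move: xi_legendre; rewrite /legendre; case: eqP => // _; case: is_square.
have M_half := root_expr_half p_prime p_odd (rotation_mx_sqr t) D_nsq t2_nsq.
have p1E : p.+1 = (p.+1./2 * 2)%N by rewrite muln2 even_halfK //= p_odd.
have n_dvd : (rotation_order i x %| p.+1)%N.
  rewrite rotation_order_dvdn; apply/eqP; apply: (@moving_coords_inj _ i).
    by elim: p.+1 => // n IHn; rewrite iterS pcoord_rotation.
  by rewrite moving_coords_iter -/t p1E exprM M_half sqrrN expr1n mul1mx.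
(* Otherwise the vector of moving coordinates would equal its own opposite, impossible as it is
   nonzero and $2 \neq 0$. *)
have n_ndvd : ~~ (rotation_order i x %| p.+1./2)%N.
  apply/negP; rewrite rotation_order_dvdn => /eqP half_x.
  have := moving_coords_iter i p.+1./2 x; rewrite -/t half_x M_half.
  rewrite mulNmx mul1mx => /eqP; rewrite -addr_eq0 -mulr2n -scaler_nat.
  rewrite scaler_eq0 (negPf (moving_coords_neq0 i x_markoff)) orbF.
  by rewrite (negPf (two_Fp_neq0 p_prime p_odd)).
(* An even cofactor [k] would make the order divide $(p + 1)/2$; as [k] is odd, the whole power of
   $2$ in $p + 1$ lies in the order. *)
have [k kE] := dvdnP n_dvd; have k_odd : odd k.
  apply: contraNT n_ndvd => /even_halfK k2; apply/dvdnP; exists k./2.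
  by apply: double_inj; rewrite -!muln2 -p1E kE mulnAC muln2 k2.
have := pfactor_dvdnn 2 p.+1; rewrite {2}kE Gauss_dvdr //.
by rewrite coprimeXl // coprime2n.
Qed.
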